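(* Let $x\in[0,1]^n$. Let $\mu$ be a distribution on $\mathcal{U}\in\{\mathcal{U}_k,\mathcal{U}_{\leq k}\}$ that is $(c,\alpha)$-near-pairwise independent with respect to $x$, i.e., for all $T,R\subseteq[n]$ each of size at most $d$, $$\frac{\Pr_{\mathcal{S}\sim\mu}[\mathcal{S}\supseteq T]}{\Pr_{\mathcal{S}\sim\mu}[\mathcal{S}\supseteq R]}\leq c\,\alpha^{|R|-|T|}\frac{x^T}{x^R}.$$ Let $\mu'$ be the $\lambda$-regularized proportional volume sampling with measure $\mu$, i.e., the distribution on $\mathcal{U}$ with $\mu'(S)\propto \mu(S)\det\left(V_SV_S^\top+\lambda I_d\right)$ for all $S\in\mathcal{U}$. Then $$\mathbb{E}_{\mathcal{S}\sim\mu'}\left[\frac{E_{d-1}\left(V_{\mathcal{S}}V_{\mathcal{S}}^\top+\lambda I_d\right)}{E_{d}\left(V_{\mathcal{S}}V_{\mathcal{S}}^\top+\lambda I_d\right)}\right]\leq c\alpha\,\frac{E_{d-1}\left(V(x)V(x)^\top+\alpha\lambda I_d\right)}{E_{d}\left(V(x)V(x)^\top+\alpha\lambda I_d\right)}.$$ That is, the sampling gives a $c\alpha$-approximation guarantee to $\alpha\lambda$-regularized $A$-optimal design in expectation.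
   Context: Given vectors $v_1,\ldots,v_n\in\mathbb{R}^d$, $V=[v_1,\ldots,v_n]\in\mathbb{R}^{d\times n}$, a positive integer $k$, and $\lambda\geq 0$. $\mathcal{U}_k$ and $\mathcal{U}_{\leq k}$ denote the sets of all subsets of $[n]$ of size exactly $k$ and at most $k$, respectively. For $S\subseteq[n]$, $V_S$ is the matrix with columns $v_i$, $i\in S$; $x^S=\prod_{i\in S}x_i$; and $V(x)=[\sqrt{x_1}v_1,\ldots,\sqrt{x_n}v_n]$. For a PSD matrix $M$, $E_j(M)$ denotes the degree-$j$ elementary symmetric polynomial of the eigenvalues of $M$ (with $E_0(M)=1$). $I_d$ is the $d\times d$ identity matrix. *)

(* Defs.v *)
From mathcomp Require Import all_boot all_order all_algebra.
From mathcomp Require Import polyrcf mpoly.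

Set Implicit Arguments.
Unset Strict Implicit.
Unset Printing Implicit Defensive.

Import Order.TTheory GRing.Theory Num.Theory.
Local Open Scope ring_scope.

(* The real eigenvalues of M, each repeated according to its multiplicity as a
   root of the characteristic polynomial.  For a symmetric M these are all of
   its eigenvalues, so that the sequence has size d. *)
Definition eigenvals (R : rcfType) (d : nat) (M : 'M[R]_d) : seq R :=
  flatten [seq nseq (mup a (char_poly M)) a | a <- rootsR (char_poly M)].

Definition esymE (R : rcfType) (d : nat) (j : nat) (M : 'M[R]_d) : R :=
  (mesym (size (eigenvals M)) R j).@[fun i => (eigenvals M)`_i].

Definition U_eq (n k : nat) : {set {set 'I_n}} :=
  [set S : {set 'I_n} | #|S| == k].

Definition U_le (n k : nat) : {set {set 'I_n}} :=
  [set S : {set 'I_n} | (#|S| <= k)%N].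

Definition cols_in (R : rcfType) (d n : nat) (V : 'M[R]_(d, n))
    (S : {set 'I_n}) : 'M[R]_(d, #|S|) :=
  colsub (fun i : 'I_#|S| => enum_val i) V.

Definition scaled_cols (R : rcfType) (d n : nat) (V : 'M[R]_(d, n))
    (x : 'I_n -> R) : 'M[R]_(d, n) :=
  \matrix_(i, j) (Num.sqrt (x j) * V i j).

(* V_S V_S^T + lambda I_d *)
Definition reg_gram (R : rcfType) (d n : nat) (V : 'M[R]_(d, n)) (lambda : R)
    (S : {set 'I_n}) : 'M[R]_d :=
  cols_in V S *m (cols_in V S)^T + lambda%:M.

(* V(x) V(x)^T + lambda I_d *)
Definition reg_gram_frac (R : rcfType) (d n : nat) (V : 'M[R]_(d, n))
    (lambda : R) (x : 'I_n -> R) : 'M[R]_d :=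
  scaled_cols V x *m (scaled_cols V x)^T + lambda%:M.

(* x^S *)
Definition set_monomial (R : rcfType) (n : nat) (x : 'I_n -> R)
    (S : {set 'I_n}) : R :=
  \prod_(i in S) x i.

Definition distribution_on (R : rcfType) (n : nat) (U : {set {set 'I_n}})
    (mu : {set 'I_n} -> R) : Prop :=
  [/\ forall S, 0 <= mu S,
      forall S, S \notin U -> mu S = 0
    & \sum_S mu S = 1].

Definition Pr_supset (R : rcfType) (n : nat) (mu : {set 'I_n} -> R)
    (T : {set 'I_n}) : R :=
  \sum_(S : {set 'I_n} | T \subset S) mu S.

Definition expectation (R : rcfType) (n : nat) (mu : {set 'I_n} -> R)
    (f : {set 'I_n} -> R) : R :=
  \sum_S mu S * f S.

(* Zero denominators are read as for extended reals: the right-hand side is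
   infinite when x^B = 0, so nothing is required; the left-hand side is
   infinite when Pr[S contains B] = 0, so this is ruled out when x^B != 0.
   This is needed because a / 0 = 0 for the division of R. *)
Definition near_pairwise_independent (R : rcfType) (d n : nat) (c alpha : R)
    (x : 'I_n -> R) (mu : {set 'I_n} -> R) : Prop :=
  forall T B : {set 'I_n}, (#|T| <= d)%N -> (#|B| <= d)%N ->
    set_monomial x B != 0 ->
    Pr_supset mu B != 0 /\
    Pr_supset mu T / Pr_supset mu B <=
      c * alpha ^ (#|B|%:Z - #|T|%:Z) * (set_monomial x T / set_monomial x B).

(* That mu' is a distribution forces the total weight
   \sum_S mu S * \det (reg_gram V lambda S) to be nonzero. *)
Definition reg_volume_sampling (R : rcfType) (d n : nat) (V : 'M[R]_(d, n))
    (lambda : R) (U : {set {set 'I_n}}) (mu mu' : {set 'I_n} -> R) : Prop :=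
  distribution_on U mu' /\
  exists kappa : R, forall S : {set 'I_n}, S \in U ->
    mu' S = kappa * (mu S * \det (reg_gram V lambda S)).

(* Main.v *)
(* By Cauchy-Binet applied to [V, I], \det (V diag(y) V^T + l I) is
   \sum_T a_T y^T l^(d - |T|) with coefficients a_T >= 0 independent of y and
   l, and E_(d-1) is its derivative in l.  Taking y to be the indicator of S,
   resp. y = x, both sides of the theorem become quotients of such sums, with
   Pr[T \subset S] in the place of x^T on the left.  After cross-multiplying,
   the inequality holds termwise: for each pair (T, B) it is exactly the
   near-pairwise independence hypothesis. *)

Require Import Defs.
From mathcomp Require Import all_boot all_order all_algebra.
From mathcomp Require Import perm polyrcf complex mpoly ring.
Import Order.TTheory GRing.Theory Num.Theory.
Local Open Scope ring_scope.

Set Implicit Arguments.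
Unset Strict Implicit.
Unset Printing Implicit Defensive.

(** * Elementary symmetric functions of the eigenvalues as coefficients of the characteristic
    polynomial *)

Lemma char_poly_similar (F : fieldType) (d : nat) (P A B : 'M[F]_d) :
  P \in unitmx -> A = invmx P *m B *m P -> char_poly A = char_poly B.
Proof.
move=> Pu ->; set Q := map_mx polyC P.
have QP : map_mx polyC (invmx P) *m Q = 1%:M by rewrite -map_mxM mulVmx // map_mx1.
have -> : char_poly (invmx P *m B *m P) =
    \det (map_mx polyC (invmx P) *m char_poly_mx B *m Q).
  rewrite /char_poly /char_poly_mx mulmxBr mulmxBl !map_mxM; congr (\det (_ - _)).
  by rewrite mul_mx_scalar -scalemxAl QP scalemx1.
by rewrite !det_mulmx mulrAC -det_mulmx QP det1 mul1r.
Qed.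

(** Over the complex extension of [R], [M] is Hermitian, hence unitarily diagonalizable with real
    eigenvalues. The factorization descends to [R] because the embedding of polynomials is
    injective. *)
Lemma symmetric_char_poly_split (R : rcfType) (d : nat) (M : 'M[R]_d) :
  M^T = M -> exists s : seq R, char_poly M = \prod_(a <- s) ('X - a%:P).
Proof.
move=> Msym; set f := real_complex R; pose A := map_mx f M.
have Areal : A \is a mxOver Num.real.
  by apply/mxOverP => i j; rewrite mxE; apply/complex_realP; exists (M i j).
have Asym : A \is symmetricmx.
  by apply/is_hermitianmxP; rewrite expr0 scale1r map_mx_id // /A map_trmx Msym.
have Aherm := realsym_hermsym Asym Areal.
have /hermitian_normalmx /orthomx_spectralP A_eq := Aherm.
have /mxOverP Dreal := hermitian_spectral_diag_real Aherm.
exists [seq complex.Re (spectral_diag A 0 i) | i <- enum 'I_d].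
apply: (map_poly_inj f).
rewrite map_char_poly -/A (char_poly_similar (spectral_unit A) A_eq).
rewrite char_poly_trig; last exact/diag_mx_is_trig.
rewrite big_map big_enum /= rmorph_prod /=; apply: eq_bigr => i _.
rewrite rmorphB /= map_polyX map_polyC /= !mxE eqxx mulr1n.
by rewrite /f (RRe_real (Dreal 0 i)).
Qed.

(** A split polynomial determines its roots as a multiset: the splitting list and [eigenvals M] both
    contain each root as often as its multiplicity. *)
Lemma char_poly_eigenvals (R : rcfType) (d : nat) (M : 'M[R]_d) :
  M^T = M -> char_poly M = \prod_(a <- eigenvals M) ('X - a%:P).
Proof.
move=> /symmetric_char_poly_split [s ps].
rewrite ps; apply: perm_big; apply/allP => a _ /=; apply/eqP.
have p0 : char_poly M != 0 by rewrite monic_neq0 ?char_poly_monic.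
rewrite -mu_prod_XsubC -ps /eigenvals count_flatten -map_comp.
rewrite sumnE big_map.
under eq_bigr => b _ do rewrite /= count_nseq /=.
have [ra|nra] := boolP (a \in rootsR (char_poly M)).
  rewrite (bigD1_seq a) ?uniq_roots //= eqxx mul1n big1 ?addn0 // => b ba.
  by rewrite (negbTE ba).
rewrite big1_seq => [|b /= br]; last first.
  by case: eqP => [ba|]; rewrite ?mul0n // -ba br in nra.
apply: mupNroot; have /roots_onP/(_ a) := roots_on_rootsR p0.
by rewrite inE => ->.
Qed.

(** Vieta's formulas; the splitting over [R] ensures that [eigenvals M] has exactly [d] entries. *)
Lemma esymE_char_poly (R : rcfType) (d j : nat) (M : 'M[R]_d) :
  M^T = M -> (j <= d)%N -> esymE j M = (-1) ^+ j * (char_poly M)`_(d - j).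
Proof.
move=> /char_poly_eigenvals pM jd.
have sz : size (eigenvals M) = d.
  by apply/succn_inj; rewrite -(size_char_poly M) pM size_prod_XsubC.
have jlt : (j < (size (eigenvals M)).+1)%N by rewrite sz.
have := mroots_coeff (in_tuple (eigenvals M)) (Ordinal jlt).
rewrite /= -pM [X in _`_(X - _)]sz => ->.
rewrite mulrA -expr2 sqrr_sign mul1r.
by rewrite /esymE; apply: meval_eq => i; rewrite (tnth_nth 0).
Qed.

Lemma esymE_det (R : rcfType) (d : nat) (M : 'M[R]_d) :
  M^T = M -> esymE d M = \det M.
Proof.
move=> Msym; rewrite esymE_char_poly // subnn char_poly_det mulrA -expr2.
by rewrite sqrr_sign mul1r.
Qed.

(** * The Cauchy-Binet formula *)

(** Multilinearity in the rows: [f i] is the row of [B] chosen when row [i] of the product is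
    expanded. *)
Lemma det_mulmx_rowsub (R : comNzRingType) (d m : nat) (A : 'M[R]_(d, m))
    (B : 'M[R]_(m, d)) :
  \det (A *m B) =
    \sum_(f : {ffun 'I_d -> 'I_m}) (\prod_i A i (f i)) * \det (rowsub f B).
Proof.
rewrite /determinant; under eq_bigr => s _.
  under eq_bigr => i _ do rewrite mxE.
  rewrite bigA_distr_bigA big_distrr /=; over.
rewrite exchange_big; apply: eq_bigr => f _ /=.
rewrite big_distrr /=; apply: eq_bigr => s _.
rewrite mulrCA big_split //=; congr (_ * (_ * _)).
by apply: eq_bigr => i _; rewrite mxE.
Qed.

(* Summing over all maps, instead of increasing ones, counts each d-subset d!
   times; non-injective maps contribute 0. *)
Lemma cauchy_binet (R : comNzRingType) (d m : nat) (A : 'M[R]_(d, m))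
    (B : 'M[R]_(m, d)) :
  d`!%:R * \det (A *m B) =
    \sum_(f : {ffun 'I_d -> 'I_m}) \det (colsub f A) * \det (rowsub f B).
Proof.
(* The factor d! becomes a sum over permutations [s]. Reindexing [f] by [s] extracts the sign of [s]
   from the minor of [B], and the signed products add up to the minor of [A]. *)
transitivity (\sum_(s : 'S_d) \det (A *m B)).
  by rewrite sumr_const card_Sn mulr_natl.
transitivity (\sum_(s : 'S_d) \sum_(f : {ffun 'I_d -> 'I_m})
   (-1) ^+ s * (\prod_i A i (f (s i))) * \det (rowsub f B)).
  apply: eq_bigr => s _; rewrite det_mulmx_rowsub.
  rewrite (reindex (fun f : {ffun 'I_d -> 'I_m} => [ffun i => f (s i)])) /=; last first.
    exists (fun f : {ffun 'I_d -> 'I_m} => [ffun i => f ((s^-1)%g i)]) => f _;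
      by apply/ffunP => i; rewrite !ffunE ?permKV ?permK.
  apply: eq_bigr => f _.
  have -> : rowsub [ffun i => f (s i)] B = row_perm s (rowsub f B).
    by apply/matrixP => i j; rewrite !mxE ffunE.
  rewrite row_permE det_mulmx det_perm mulrA; congr (_ * _); rewrite mulrC.
  by congr (_ * _); apply: eq_bigr => i _; rewrite ffunE.
rewrite exchange_big; apply: eq_bigr => f _ /=; rewrite -big_distrl /=.
by congr (_ * _); apply: eq_bigr => s _; congr (_ * _); apply: eq_bigr => i _; rewrite mxE.
Qed.

(** * Expansion of E_d and E_(d-1) over sets of columns *)

(** Common form, free of square roots, of the Gram matrices of [V_S] and [V(x)]. The ring is general
    because polynomial entries also occur below. *)
Definition weighted_gram (R : comNzRingType) (d n : nat) (V : 'M[R]_(d, n))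
    (y : 'I_n -> R) : 'M[R]_d :=
  V *m diag_mx (\row_j y j) *m V^T.

Lemma weighted_gramE (R : comNzRingType) (d n : nat) (V : 'M[R]_(d, n))
    (y : 'I_n -> R) i j :
  weighted_gram V y i j = \sum_k y k * (V i k * V j k).
Proof.
rewrite mxE; apply: eq_bigr => k _.
by rewrite mul_mx_diag !mxE mulrAC mulrC.
Qed.

Lemma weighted_gram_reg_sym (R : comNzRingType) (d n : nat) (V : 'M[R]_(d, n))
    (y : 'I_n -> R) (l : R) :
  (weighted_gram V y + l%:M)^T = weighted_gram V y + l%:M.
Proof.
by rewrite linearD /= tr_scalar_mx !trmx_mul trmxK tr_diag_mx mulmxA.
Qed.

Lemma reg_gramE (R : rcfType) (d n : nat) (V : 'M[R]_(d, n)) (lambda : R)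
    (S : {set 'I_n}) :
  reg_gram V lambda S = weighted_gram V (fun j => (j \in S)%:R) + lambda%:M.
Proof.
congr (_ + _); apply/matrixP => i j; rewrite weighted_gramE mxE.
under eq_bigr => k _ do rewrite !mxE.
rewrite -(big_enum_val (A := mem S) (fun k => V i k * V j k)) big_mkcond /=.
by apply: eq_bigr => k _; rewrite mulr_natl mulrb.
Qed.

Lemma reg_gram_fracE (R : rcfType) (d n : nat) (V : 'M[R]_(d, n)) (lambda : R)
    (x : 'I_n -> R) :
  (forall i, 0 <= x i) ->
  reg_gram_frac V lambda x = weighted_gram V x + lambda%:M.
Proof.
move=> x0; congr (_ + _); apply/matrixP => i j; rewrite weighted_gramE mxE.
by apply: eq_bigr => k _; rewrite !mxE mulrACA -expr2 sqr_sqrtr.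
Qed.

(** Injectivity turns the product over [i] into one over the image of [f]: the set [T] in the left
    block and [d - #|T|] indices in the right block. *)
Lemma prod_split_inj (R : comNzRingType) (d n m : nat) (f : 'I_d -> 'I_(n + m))
    (w : 'I_n -> R) (t : R) :
  injective f ->
  let T := [set j | lshift m j \in codom f] in
  (#|T| <= d)%N /\
  \prod_i (match split (f i) with inl j => w j | inr _ => t end) =
  (\prod_(j in T) w j) * t ^+ (d - #|T|).
Proof.
move=> finj T.
have prodE : forall (K : comNzRingType) (F : 'I_(n + m) -> K), \prod_i F (f i) =
    (\prod_(j in T) F (lshift m j)) *
    \prod_(j | rshift n j \in codom f) F (rshift n j).
  move=> K F; rewrite -(big_image _ _ f) /= big_uniq ?map_inj_uniq -?enumT ?enum_uniq //=.
  rewrite big_split_ord /=; congr (_ * _); apply: eq_bigl => j.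
  by rewrite inE.
have cardE : d = (#|T| + #|[pred j | rshift n j \in codom f]|)%N.
  (* Comparing degrees in the case where every factor is 'X. *)
  have := prodE _ (fun=> 'X : {poly int}).
  rewrite !prodr_const -exprD card_ord => /(congr1 (fun p : {poly int} => size p)).
  by rewrite !size_polyXn => -[].
split; first by rewrite [X in (_ <= X)%N]cardE leq_addr.
rewrite (prodE _ (fun k => match split k with inl j => w j | inr _ => t end)).
congr (_ * _).
  by apply: eq_bigr => j _; rewrite (unsplitK (inl j)).
rewrite [X in (X - _)%N]cardE addKn -prodr_const.
by apply: eq_bigr => j _; rewrite (unsplitK (inr j)).
Qed.

(** With [W = [V, I]], the characteristic matrix is [W diag(w) W^T], with weights [- y j] on the
    columns of [V] and ['X - l] on those of [I]. Cauchy-Binet gives squared minors of [W]; [a T]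
    collects, up to 1/d!, those using exactly the columns [T] of [V], hence is nonnegative. *)
Lemma char_poly_gram_expansion (R : realFieldType) (d n : nat)
    (V : 'M[R]_(d, n)) :
  exists a : {set 'I_n} -> R,
    [/\ forall T, 0 <= a T, forall T : {set 'I_n}, (d < #|T|)%N -> a T = 0
      & forall (y : 'I_n -> R) (l : R),
        char_poly (weighted_gram V y + l%:M) =
        \sum_T (a T * \prod_(j in T) - y j) *: ('X - l%:P) ^+ (d - #|T|)].
Proof.
pose W : 'M[R]_(d, n + d) := row_mx V 1%:M.
pose T (f : {ffun 'I_d -> 'I_(n + d)}) := [set j | lshift d j \in codom f].
pose b (f : {ffun 'I_d -> 'I_(n + d)}) := (d`!%:R)^-1 * \det (colsub f W) ^+ 2.
have b_ge0 f : 0 <= b f by rewrite mulr_ge0 ?invr_ge0 ?ler0n ?sqr_ge0.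
(* If [f] takes a value twice, the selected minor has two equal columns. *)
have b_inj f : b f != 0 -> injective f.
  move=> bf i j fij; apply/eqP; apply: contraTT bf => ij; rewrite negbK /b -det_tr.
  rewrite (determinant_alternate ij) ?expr0n ?mulr0 // => k.
  by rewrite !mxE fij.
exists (fun A => \sum_(f | T f == A) b f); split.
- by move=> A; apply: sumr_ge0.
- move=> A dA; apply: big1 => f /eqP TfA; apply/eqP; apply: contraTT dA => /b_inj fi.
  by rewrite -leqNgt -TfA; have [] := prod_split_inj (fun=> 1 : R) 1 fi.
move=> y l; pose w (k : 'I_(n + d)) : {poly R} :=
  match split k with inl j => (- y j)%:P | inr _ => 'X - l%:P end.
pose WC := map_mx polyC W.
have WCl i k : WC i (lshift d k) = (V i k)%:P by rewrite mxE row_mxEl.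
have WCr i k : WC i (rshift n k) = (i == k)%:R by rewrite mxE row_mxEr mxE rmorph_nat.
have wl k : w (lshift d k) = (- y k)%:P by rewrite /w (unsplitK (inl k)).
have wr k : w (rshift n k) = 'X - l%:P by rewrite /w (unsplitK (inr k)).
have -> : char_poly (weighted_gram V y + l%:M) =
    \det ((WC *m diag_mx (\row_k w k)) *m WC^T).
  congr (\det _); apply/matrixP => i j.
  have -> : char_poly_mx (weighted_gram V y + l%:M) i j =
      'X *+ (i == j) - (weighted_gram V y i j + l *+ (i == j))%:P by rewrite !mxE.
  rewrite -[RHS]/(weighted_gram WC w i j) !weighted_gramE big_split_ord /=.
  under [X in _ = X + _]eq_bigr => k _ do rewrite wl !WCl -!polyCM mulNr.
  under [X in _ = _ + X]eq_bigr => k _ do rewrite wr !WCr.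
  rewrite (bigD1 (P := xpredT) i) //= [X in _ = _ + (_ + X)]big1 => [|k ki]; last first.
    by rewrite [i == k]eq_sym (negbTE ki) mul0r mulr0.
  rewrite -rmorph_sum sumrN /= eqxx eq_sym.
  by case: eqP => _; rewrite ?mulr1n ?mulr0n !polyCD ?polyC0 polyCN; ring.
have fact_unit : (d`!%:R : {poly R}) != 0.
  by rewrite -polyC_natr polyC_eq0 pnatr_eq0 -lt0n fact_gt0.
apply: (mulfI fact_unit); rewrite cauchy_binet.
transitivity (d`!%:R * \sum_f (b f * \prod_(j in T f) - y j) *:
   ('X - l%:P) ^+ (d - #|T f|)); last first.
  congr (_ * _); rewrite (partition_big T predT) //=; apply: eq_bigr => A _.
  rewrite big_distrl scaler_suml /=.
  by apply: eq_bigr => f /eqP ->.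
rewrite big_distrr; apply: eq_bigr => f _ /=.
have -> : \det (colsub f (WC *m diag_mx (\row_k w k))) =
   \det (colsub f WC) * \prod_i w (f i).
  have -> : \prod_i w (f i) = \det (diag_mx (\row_i w (f i))).
    by rewrite det_diag; apply: eq_bigr => i _; rewrite mxE.
  rewrite -det_mulmx; congr (\det _); apply/matrixP => i j.
  by rewrite mul_mx_diag [in RHS]mul_mx_diag !mxE.
have -> : rowsub f WC^T = (colsub f WC)^T by apply/matrixP => i j; rewrite !mxE.
have -> : colsub f WC = map_mx polyC (colsub f W) by apply/matrixP => i j; rewrite !mxE.
rewrite det_tr det_map_mx mulrAC -expr2 -polyC_exp.
have -> : \det (colsub f W) ^+ 2 = d`!%:R * b f.
  by rewrite mulVKf // pnatr_eq0 -lt0n fact_gt0.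
have [->|/b_inj finj] := eqVneq (b f) 0.
  by rewrite mulr0 mul0r mul0r scale0r mulr0.
have [_ ->] := prod_split_inj (fun j => (- y j)%:P) ('X - l%:P) finj.
by move: (b f) => bf; rewrite -rmorph_prod !polyCM polyC_natr -mul_polyC polyCM !mulrA.
Qed.

Lemma coef0_XsubC_exp (R : comNzRingType) (l : R) m :
  (('X - l%:P) ^+ m)`_0 = (- l) ^+ m.
Proof. by rewrite -horner_coef0 horner_exp !hornerE. Qed.

(** At [m = 0] the factor [*+ m] makes the truncated exponent [m.-1] harmless. *)
Lemma coef1_XsubC_exp (R : comNzRingType) (l : R) m :
  (('X - l%:P) ^+ m)`_1 = (- l) ^+ m.-1 *+ m.
Proof.
rewrite -[LHS]mulr1n -coef_deriv deriv_exp derivXsubC mul1r coefMn.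
by rewrite coef0_XsubC_exp.
Qed.

(** Up to sign, E_d and E_(d-1) are the coefficients of 1 and ['X] in the previous expansion. *)
Lemma esymE_gram_expansion (R : rcfType) (d n : nat) (V : 'M[R]_(d, n)) :
  (0 < d)%N ->
  exists a : {set 'I_n} -> R,
    [/\ forall T, 0 <= a T, forall T : {set 'I_n}, (d < #|T|)%N -> a T = 0,
        forall (y : 'I_n -> R) (l : R), esymE d (weighted_gram V y + l%:M) =
          \sum_T a T * set_monomial y T * l ^+ (d - #|T|)
      & forall (y : 'I_n -> R) (l : R), esymE d.-1 (weighted_gram V y + l%:M) =
          \sum_T a T * set_monomial y T * (l ^+ (d - #|T|).-1 *+ (d - #|T|))].
Proof.
move=> d0; have [a [a_ge0 a_big aE]] := char_poly_gram_expansion V.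
(* The sign of the coefficient cancels those of the [p = #|T|] factors [- y j] and of the [q]
   factors [- l]. *)
have signK p q (u v w : R) :
    (-1) ^+ (p + q) * (u * ((-1) ^+ p * v) * ((-1) ^+ q * w)) = u * v * w.
  have sgn m : (-1) ^+ m * (-1) ^+ m = 1 :> R by rewrite -expr2 sqrr_sign.
  rewrite exprD; have := sgn p; have := sgn q.
  move: ((-1) ^+ p) ((-1) ^+ q) => s t tt ss.
  transitivity (s * s * (t * t) * (u * v * w)); first by ring.
  by rewrite ss tt !mul1r.
exists a; split=> // y l;
  rewrite esymE_char_poly ?weighted_gram_reg_sym ?leq_pred // aE.
  rewrite subnn coef_sum big_distrr; apply: eq_bigr => T _ /=.
  (* Beyond size [d] the subtraction is truncated and the exponents no longer add up to [d], but
     there [a T = 0]. *)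
  have [/a_big->|Td] := ltnP d #|T|; first by rewrite !mul0r scale0r coef0 mulr0.
  rewrite coefZ coef0_XsubC_exp prodrN [(- l) ^+ _]exprNn -/(set_monomial y T).
  by rewrite -{1}(subnKC Td) signK.
have -> : (d - d.-1 = 1)%N by rewrite -subn1 subKn.
rewrite coef_sum big_distrr; apply: eq_bigr => T _ /=.
have [/a_big->|Td] := ltnP d #|T|; first by rewrite !mul0r scale0r coef0 mulr0.
rewrite coefZ coef1_XsubC_exp; case def_m: (d - #|T|)%N => [|m] /=.
  by rewrite !mulr0n !mulr0.
rewrite prodrN [(- l) ^+ _]exprNn -/(set_monomial y T).
have -> : d.-1 = (#|T| + m)%N by rewrite -(subnKC Td) def_m addnS.
by rewrite -mulrnAr signK.
Qed.

(** * Averages under [mu] in terms of inclusion probabilities *)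

Lemma set_monomial_indicator (R : rcfType) (n : nat) (S T : {set 'I_n}) :
  set_monomial (fun j => (j \in S)%:R : R) T = (T \subset S)%:R.
Proof.
rewrite /set_monomial; case: (boolP (T \subset S)) => [/subsetP TS|].
  by apply: big1 => j /TS ->.
by case/subsetPn => j jT /negbTE jS; rewrite (bigD1 j) //= jS mul0r.
Qed.

Lemma set_monomial_ge0 (R : rcfType) (n : nat) (x : 'I_n -> R) (T : {set 'I_n}) :
  (forall i, 0 <= x i) -> 0 <= set_monomial x T.
Proof. by move=> x0; apply: prodr_ge0. Qed.

Lemma Pr_supset_ge0 (R : rcfType) (n : nat) (mu : {set 'I_n} -> R)
    (T : {set 'I_n}) :
  (forall S, 0 <= mu S) -> 0 <= Pr_supset mu T.
Proof. by move=> mu0; apply: sumr_ge0. Qed.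

(** The monomial of the indicator of [S] at [T] is 1 or 0 according to whether [T \subset S], so its
    mean is [Pr_supset mu T]. *)
Lemma expectation_expansion (R : rcfType) (n : nat) (mu : {set 'I_n} -> R)
    (a p : {set 'I_n} -> R) :
  expectation mu
    (fun S => \sum_T a T * set_monomial (fun j => (j \in S)%:R) T * p T) =
  \sum_T a T * Pr_supset mu T * p T.
Proof.
rewrite /expectation; under eq_bigr do rewrite big_distrr /=.
rewrite exchange_big; apply: eq_bigr => T _ /=.
rewrite /Pr_supset [in RHS]big_mkcond big_distrr big_distrl /=; apply: eq_bigr => S _.
by rewrite set_monomial_indicator; case: (T \subset S) => /=; ring.
Qed.

(** * Consequences of near-pairwise independence *)

Section NearPairwiseIndependent.
Variables (R : rcfType) (d n : nat) (c alpha : R) (x : 'I_n -> R).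
Variable mu : {set 'I_n} -> R.
Hypotheses (x_ge0 : forall i, 0 <= x i) (alpha_gt0 : 0 < alpha).
Hypotheses (mu_ge0 : forall S, 0 <= mu S) (mu_sum : \sum_S mu S = 1).
Hypothesis mu_npi : near_pairwise_independent d c alpha x mu.

Let monomial0 : set_monomial x set0 = 1.
Proof. exact: big_set0. Qed.

Let Pr_supset0 : Pr_supset mu set0 = 1.
Proof. by rewrite -mu_sum; apply: eq_bigl => S; rewrite sub0set. Qed.

(** With both sets empty the hypothesis reads [1 <= c]. *)
Lemma npi_const_ge0 : 0 <= c.
Proof.
have := mu_npi (T := set0) (B := set0).
rewrite cards0 leq0n monomial0 Pr_supset0 oner_neq0 => /(_ isT isT isT)[_].
by rewrite subrr expr0z !divr1 !mulr1; apply: le_trans.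
Qed.

(* Independence with B empty, where x^B = 1. *)
Lemma npi_support (T : {set 'I_n}) :
  (#|T| <= d)%N -> Pr_supset mu T != 0 -> set_monomial x T != 0.
Proof.
move=> Td; apply: contra_neq => xT.
have := mu_npi (B := set0) Td.
rewrite cards0 leq0n monomial0 Pr_supset0 oner_neq0 => /(_ isT isT)[_].
rewrite xT mul0r mulr0 divr1 => PrT; apply/eqP.
by rewrite eq_le PrT Pr_supset_ge0.
Qed.

(** The hypothesis without denominators, which also covers [x^B = 0]: the left side then vanishes
    and the right side is nonnegative. *)
Lemma npi_cross (T B : {set 'I_n}) :
  (#|T| <= d)%N -> (#|B| <= d)%N ->
  Pr_supset mu T * set_monomial x B * alpha ^+ (d - #|B|) <=
  c * alpha ^+ (d - #|T|) * set_monomial x T * Pr_supset mu B.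
Proof.
move=> Td Bd; have [->|xB] := eqVneq (set_monomial x B) 0.
  rewrite mulr0 mul0r !mulr_ge0 ?npi_const_ge0 ?exprn_ge0 ?(ltW alpha_gt0) //.
    exact: set_monomial_ge0.
  exact: Pr_supset_ge0.
have [PrB] := mu_npi Td Bd xB.
have PrB_gt0 : 0 < Pr_supset mu B by rewrite lt_neqAle eq_sym PrB Pr_supset_ge0.
have xB_gt0 : 0 < set_monomial x B by rewrite lt_neqAle eq_sym xB set_monomial_ge0.
(* Natural exponents of the form [d - #|T|] match the powers of [alpha * lambda] in the
   expansions. *)
have -> : alpha ^ (#|B|%:Z - #|T|%:Z) = alpha ^+ (d - #|T|) / alpha ^+ (d - #|B|).
  rewrite !exprnP invr_expz -expfzDr ?gt_eqF //; congr (_ ^ _).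
  by rewrite -!subzn //; ring.
have aB_gt0 : 0 < alpha ^+ (d - #|B|) by apply: exprn_gt0.
rewrite ler_pdivrMr // => /(ler_wpM2r (ltW (mulr_gt0 xB_gt0 aB_gt0))).
rewrite mulrA => /le_trans; apply; rewrite le_eqVlt; apply/orP; left; apply/eqP.
by field; rewrite !gt_eqF.
Qed.

End NearPairwiseIndependent.

(** * Reduction from [mu'] to expectations under [mu] *)

(** The determinant in the density of [mu'] cancels the denominator. Only an inequality results: a
    set with zero determinant contributes 0 on the left but possibly a positive amount to
    [expectation mu g]. *)
Lemma reg_volume_sampling_expectation_le (R : rcfType) (d n : nat)
    (V : 'M[R]_(d, n)) (lambda : R) (U : {set {set 'I_n}})
    (mu mu' : {set 'I_n} -> R) (g : {set 'I_n} -> R) :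
  distribution_on U mu -> reg_volume_sampling V lambda U mu mu' ->
  (forall S, 0 <= \det (reg_gram V lambda S)) -> (forall S, 0 <= g S) ->
  0 < expectation mu (fun S => \det (reg_gram V lambda S)) /\
  expectation mu' (fun S => g S / \det (reg_gram V lambda S)) <=
  expectation mu g / expectation mu (fun S => \det (reg_gram V lambda S)).
Proof.
move=> [mu_ge0 mu_out _] [[_ mu'_out mu'_sum] [kappa mu'E]] det_ge0 g_ge0.
set D := expectation mu _.
have {mu'_out}mu'E S : mu' S = kappa * (mu S * \det (reg_gram V lambda S)).
  have [/mu'E //|SU] := boolP (S \in U).
  by rewrite mu_out // mul0r mulr0 mu'_out.
(* Total mass 1 of [mu'] identifies [kappa] as the inverse of [D]. *)
have kD : kappa * D = 1.
  by rewrite -mu'_sum big_distrr; apply: eq_bigr => S _; rewrite mu'E.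
have D_ge0 : 0 <= D by apply: sumr_ge0 => S _; rewrite mulr_ge0.
have D_neq0 : D != 0 by apply/eqP => D0; move/eqP: kD; rewrite D0 mulr0 eq_sym oner_eq0.
have D_gt0 : 0 < D by rewrite lt_neqAle eq_sym D_neq0.
have kappaE : kappa = D^-1 by apply: (mulIf D_neq0); rewrite kD mulVf.
have kappa_ge0 : 0 <= kappa by rewrite kappaE invr_ge0.
split=> //; rewrite -kappaE mulrC big_distrr /=; apply: ler_sum => S _.
rewrite mu'E; have [->|detS] := eqVneq (\det (reg_gram V lambda S)) 0.
  by rewrite !mulr0 mul0r !mulr_ge0.
by rewrite -!mulrA [_ * (g S / _)]mulrCA mulfV // mulr1.
Qed.

(** * Termwise comparison of the two quotients *)

Theorem theorem4 (R : rcfType) (d n k : nat) (V : 'M[R]_(d, n)) (lambda : R)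
    (U : {set {set 'I_n}}) (x : 'I_n -> R) (c alpha : R)
    (mu mu' : {set 'I_n} -> R)
    (hd : (0 < d)%N) (hk : (0 < k)%N) (hlambda : 0 <= lambda)
    (hU : U = U_eq n k \/ U = U_le n k)
    (hx : forall i, 0 <= x i <= 1)
    (halpha : 0 < alpha)
    (hmu : distribution_on U mu)
    (hnpi : near_pairwise_independent d c alpha x mu)
    (hmu' : reg_volume_sampling V lambda U mu mu') :
  expectation mu' (fun S => esymE d.-1 (reg_gram V lambda S) /
                            esymE d (reg_gram V lambda S)) <=
  c * alpha * (esymE d.-1 (reg_gram_frac V (alpha * lambda) x) /
               esymE d (reg_gram_frac V (alpha * lambda) x)).
Proof.
have x_ge0 i : 0 <= x i by have /andP[] := hx i.
have [mu_ge0 _ mu_sum] := hmu.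
have [a [a_ge0 a_big Ed Ed1]] := esymE_gram_expansion V hd.
pose w (T : {set 'I_n}) := lambda ^+ (d - #|T|).
(* The derivative of [w T] with respect to [lambda]. *)
pose w1 (T : {set 'I_n}) := lambda ^+ (d - #|T|).-1 *+ (d - #|T|).
have w_ge0 T : 0 <= w T by rewrite exprn_ge0.
have w1_ge0 T : 0 <= w1 T by rewrite mulrn_wge0 ?exprn_ge0.
pose y (S : {set 'I_n}) j : R := (j \in S)%:R.
have detE S : \det (reg_gram V lambda S) = \sum_T a T * set_monomial (y S) T * w T.
  by rewrite -Ed -reg_gramE esymE_det // reg_gramE weighted_gram_reg_sym.
have E1E S : esymE d.-1 (reg_gram V lambda S) =
    \sum_T a T * set_monomial (y S) T * w1 T.
  by rewrite reg_gramE Ed1.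
have term_ge0 z p T : (forall i, 0 <= z i) -> 0 <= p T ->
    0 <= a T * set_monomial z T * p T.
  by move=> z0 pT; rewrite !mulr_ge0 ?set_monomial_ge0.
have [] := @reg_volume_sampling_expectation_le _ _ _ _ _ _ _ _
  (fun S => esymE d.-1 (reg_gram V lambda S)) hmu hmu'.
- by move=> S; rewrite detE; apply: sumr_ge0 => T _; apply: term_ge0.
- by move=> S; rewrite E1E; apply: sumr_ge0 => T _; apply: term_ge0.
have -> : expectation mu (fun S => \det (reg_gram V lambda S)) =
    \sum_T a T * Pr_supset mu T * w T.
  by rewrite -expectation_expansion; apply: eq_bigr => S _; rewrite detE.
have -> : expectation mu (fun S => esymE d.-1 (reg_gram V lambda S)) =
    \sum_T a T * Pr_supset mu T * w1 T.
  by rewrite -expectation_expansion; apply: eq_bigr => S _; rewrite E1E.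
set D := \sum_T _; set N := \sum_T _ => D_gt0 leN.
apply: le_trans (_ : N / D <= _).
  apply: le_trans leN; rewrite le_eqVlt; apply/orP; left; apply/eqP.
  apply: eq_bigr => S _.
  by rewrite [esymE d _]esymE_det // reg_gramE weighted_gram_reg_sym.
rewrite reg_gram_fracE // Ed Ed1.
set N' := \sum_T _; set D' := \sum_T _.
have aw_ge0 (T : {set 'I_n}) : 0 <= (alpha * lambda) ^+ (d - #|T|).
  by rewrite exprn_ge0 ?mulr_ge0 ?(ltW halpha).
(* A set with a positive term in [D] has [x^T] nonzero by [npi_support], so its term in [D'] is
   positive too. *)
have D'_gt0 : 0 < D'.
  have [T PT] : exists T, 0 < a T * Pr_supset mu T * w T.
    apply/existsP; apply: contraTT D_gt0; rewrite negb_exists => /forallP nT.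
    by rewrite -leNgt; apply: sumr_le0 => T _; rewrite leNgt.
  have : a T * Pr_supset mu T * w T != 0 by rewrite gt_eqF.
  rewrite !mulf_eq0 !negb_or -andbA => /and3P[aT PrT wT].
  have Td : (#|T| <= d)%N.
    by rewrite leqNgt; apply: contra_neqN aT => /a_big.
  have xT := npi_support mu_ge0 mu_sum hnpi Td PrT.
  rewrite /D' (bigD1 T) //= ltr_wpDr //.
    by apply: sumr_ge0 => B _; apply: (term_ge0 _ (fun T : {set 'I_n} => _ ^+ (d - #|T|))).
  rewrite lt_neqAle eq_sym (term_ge0 _ (fun T : {set 'I_n} => _ ^+ (d - #|T|))) // andbT.
  by rewrite exprMn !mulf_neq0 // expf_neq0 // gt_eqF.
(* It remains to show [N * D' <= c * alpha * N' * D]; below, [B] indexes [D'] and [D], while [T]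
   indexes [N] and [N']. *)
rewrite mulrA ler_pdivlMr // mulrAC ler_pdivrMr //.
rewrite mulrC /D' big_distrl [X in X <= _]/= [X in _ <= X]mulrC.
rewrite /D big_distrl; apply: ler_sum => B _ /=.
have [/a_big->|Bd] := ltnP d #|B|; first by rewrite !mul0r.
rewrite /N /N' [c * alpha * _]mulr_sumr [X in X <= _]mulr_sumr.
rewrite [X in _ <= X]mulr_sumr; apply: ler_sum => T _ /=.
have [/a_big->|Td] := ltnP d #|T|; first by rewrite !mul0r !mulr0.
have := npi_cross x_ge0 halpha mu_ge0 mu_sum hnpi Td Bd.
(* For [#|T| = d] both terms vanish. Otherwise [npi_cross] supplies [alpha ^+ m.+1] while [N']
   contains only [alpha ^+ m]; the remaining [alpha] is the one in the factor [c * alpha]. *)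
rewrite /w /w1; case: (d - #|T|)%N => [|m] /=; first by rewrite !mulr0n !mulr0.
have q_ge0 : 0 <= a B * lambda ^+ (d - #|B|) * (a T * (lambda ^+ m *+ m.+1)).
  by rewrite !mulr_ge0 ?mulrn_wge0 ?exprn_ge0.
move=> /(ler_wpM2l q_ge0); rewrite !exprMn exprS -(mulr_natr (lambda ^+ m)).
rewrite -(mulr_natr (alpha ^+ m * lambda ^+ m)).
move: (m.+1%:R) (alpha ^+ m) (lambda ^+ m) (alpha ^+ _) (lambda ^+ _) => q am lm ab lb.
by congr (_ <= _); ring.
Qed.
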